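(* Let $B$ be an algebra with a nontrivial covering $(J_i)_{i\in I}$, let $B_i=B/J_i$ with quotient maps $\pi_i:B\to B_i$, and let $\Gamma(B)$, $\Gamma(B_i)$ be differential calculi over $B$ and $B_i$ such that $(\Gamma(B),(\Gamma(B_i))_{i\in I})$ is adapted to $(B,(J_i)_{i\in I})$. Let $B_c$ be the covering completion of $B$ with respect to $(J_i)_{i\in I}$. Then the covering completion of $\Gamma(B)$ with respect to the covering $(\ker\pi_{i_\Gamma})_{i\in I}$, with the componentwise grading and differential $d((\gamma_i)_{i\in I})=(d\gamma_i)_{i\in I}$ and with the covering formed by the kernels of its projections onto the components $\Gamma(B)/\ker\pi_{i_\Gamma}$, is an LC differential algebra over $B_c$.
   Context: Algebras are associative unital algebras over $\mathbb{C}$; ideals are two-sided. A finite family $(J_i)_{i\in I}$ of ideals of an algebra $B$ is a covering if $\bigcap_iJ_i=\{0\}$, and nontrivial if moreover $J_i\neq\{0\}$ for all $i$. The covering completion of $B$ with respect to $(J_i)$ is $B_c=\{(a_i)\in\bigoplus_iB/J_i\mid \pi^i_j(a_i)=\pi^j_i(a_j)\ \forall i,j\}$, where $\pi^i_j:B/J_i\to B/(J_i+J_j)$ is the canonical map. The covering is complete if $B\to B_c$, $b\mapsto(b+J_i)_i$, is surjective. A differential algebra over $B$ is an $\mathbb{N}$-graded algebra $\Gamma(B)=\bigoplus_{n\ge0}\Gamma^n(B)$ with $\Gamma^0(B)=B$ and a linear map $d$ with $d\Gamma^n(B)\subset\Gamma^{n+1}(B)$, $d(\rho\eta)=(d\rho)\eta+(-1)^n\rho\,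 d\eta$ for $\rho\in\Gamma^n(B)$, and $d^2=0$. It is a differential calculus if every element of $\Gamma^n(B)$ is a finite sum of elements $a_0\,da_1\cdots da_n$, $a_k\in B$. A differential ideal is an ideal stable under $d$ and under the projections $pr_n$ onto the homogeneous components. An algebra homomorphism $\Psi:A\to B$ is differentiable with respect to differential calculi $\Gamma(A),\Gamma(B)$ if it extends to a (degree-preserving, $d$-commuting) homomorphism $\Psi_\Gamma:\Gamma(A)\to\Gamma(B)$. $(\Gamma(B),(\Gamma(B_i))_{i\in I})$ is adapted to $(B,(J_i)_{i\in I})$ if all $\pi_i$ are differentiable and $\bigcap_i\ker\pi_{i_\Gamma}=\{0\}$. A covering of a differential algebra $\Gamma(A)$ over $A$ is differentiable if it consists of differential ideals, and nontrivial with respect to $A$ if the degree-zero components $pr_0$ of its ideals form a nontrivial covering of $A$. An LC differential algebra over $A$ is a differential algebra $\Gamma(A)$ over $A$ with a complete differentiable covering $(I_i)_i$, nontrivial with respect to $A$, such that each $\Gamma(A)/I_i$ is a differential calculus over $A/pr_0(I_i)$. *)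

(* Defs.v *)
From HB Require Import structures.
From mathcomp Require Import all_boot all_order all_algebra.
From mathcomp Require Import generic_quotient ring_quotient.
From mathcomp Require Import boolp reals complex.

Set Implicit Arguments.
Unset Strict Implicit.
Unset Printing Implicit Defensive.

Import GRing.Theory.
Local Open Scope ring_scope.
Local Open Scope quotient_scope.

(* The algebra structures of the library (algType, lalgType) require 1 != 0,   *)
(* but the quotients B / (J_i + J_j) below are in general zero algebras.  So   *)
(* an algebra over K is a possibly trivial ring with a compatible scaling; it  *)
(* is then made a canonical lmodType, and scaling is written a *: x as usual.  *)
HB.mixin Record PzRing_isPzAlgebra (K : pzRingType) A of GRing.PzRing A := {
  pzscale : K -> A -> A;
  pzscaleA : forall a b x, pzscale a (pzscale b x) = pzscale (a * b) x;
  pzscale1 : left_id 1 pzscale;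
  pzscaleDr : right_distributive pzscale +%R;
  pzscaleDl : forall x, {morph pzscale^~ x : a b / a + b};
  pzscaleAl : forall (a : K) (x y : A), pzscale a (x * y) = pzscale a x * y;
  pzscaleAr : forall (a : K) (x y : A), pzscale a (x * y) = x * pzscale a y
}.

#[short(type="pzAlgType")]
HB.structure Definition PzAlgebra (K : pzRingType) :=
  {A of GRing.PzRing A & PzRing_isPzAlgebra K A}.

HB.instance Definition _ (K : pzRingType) (A : pzAlgType K) :=
  GRing.Zmodule_isLmodule.Build K (@PzAlgebra.sort K A)
    (@pzscaleA K A) (@pzscale1 K A) (@pzscaleDr K A) (@pzscaleDl K A).

Lemma pz_scalerAl (K : pzRingType) (A : pzAlgType K) (a : K) (x y : A) :
  a *: (x * y) = (a *: x) * y.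
Proof. exact: pzscaleAl. Qed.

Lemma pz_scalerAr (K : pzRingType) (A : pzAlgType K) (a : K) (x y : A) :
  a *: (x * y) = x * (a *: y).
Proof. exact: pzscaleAr. Qed.

Record algHom (K : pzRingType) (A B : pzAlgType K) := AlgHom {
  alg_hom :> A -> B;
  alg_hom_linear : linear alg_hom;
  alg_hom_monoid : monoid_morphism alg_hom
}.

HB.instance Definition _ (K : pzRingType) (A B : pzAlgType K) (f : algHom A B) :=
  GRing.isLinear.Build K A B *:%R f (alg_hom_linear f).
HB.instance Definition _ (K : pzRingType) (A B : pzAlgType K) (f : algHom A B) :=
  GRing.isMonoidMorphism.Build A B f (alg_hom_monoid f).

Section Ideals.
Variable K : pzRingType.

(* Closure under scaling is automatic, as a *: x = (a *: 1) * x. *)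
Record ideal (A : pzAlgType K) := Ideal {
  ideal_pred :> {pred A};
  ideal_zmod : zmod_closed ideal_pred;
  idealMl : forall a x, x \in ideal_pred -> a * x \in ideal_pred;
  idealMr : forall a x, x \in ideal_pred -> x * a \in ideal_pred
}.

HB.instance Definition _ (A : pzAlgType K) (I : ideal A) :=
  GRing.isZmodClosed.Build A (ideal_pred I) (ideal_zmod I).

Section Quotient.
Variables (A : pzAlgType K) (I : ideal A).

Definition quot_alg := Quotient.quot (ideal_pred I).
HB.instance Definition _ := GRing.Zmodule.on quot_alg.
HB.instance Definition _ := EqQuotient.on quot_alg.

Definition quot_pi : A -> quot_alg := \pi_quot_alg.

Lemma quot_piP x y : reflect (quot_pi x = quot_pi y) (x - y \in ideal_pred I).
Proof.
apply: (iffP idP) => [xy|]; last by move/eqP; rewrite eqmodE.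
by apply/eqP; rewrite eqmodE.
Qed.

Lemma quot_pi_repr x : quot_pi (repr x) = x. Proof. exact: reprK. Qed.

Lemma quot_pi_ind (P : quot_alg -> Prop) : (forall x, P (quot_pi x)) -> forall x, P x.
Proof. by move=> h x; rewrite -(quot_pi_repr x). Qed.

Lemma repr_quot_pi x : repr (quot_pi x) - x \in ideal_pred I.
Proof. by apply/quot_piP; rewrite quot_pi_repr. Qed.

Lemma quot_pi_is_zmod_morphism : zmod_morphism quot_pi.
Proof. exact: raddfB. Qed.

HB.instance Definition _ :=
  GRing.isZmodMorphism.Build A quot_alg quot_pi quot_pi_is_zmod_morphism.

Let one := quot_pi 1.
Let mul (x y : quot_alg) := quot_pi (repr x * repr y).
Let scale a (x : quot_alg) := quot_pi (a *: repr x).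

Let mulE x y : mul (quot_pi x) (quot_pi y) = quot_pi (x * y).
Proof.
apply/quot_piP; set x' := repr _; set y' := repr _.
have -> : x' * y' - x * y = x' * (y' - y) + (x' - x) * y.
  by rewrite mulrBr mulrBl addrA subrK.
by apply: rpredD; [apply: idealMl|apply: idealMr]; exact: repr_quot_pi.
Qed.

Let scaleE a x : scale a (quot_pi x) = quot_pi (a *: x).
Proof.
apply/quot_piP; rewrite -scalerBr -[_ - _]mul1r pz_scalerAl.
by apply: idealMl; exact: repr_quot_pi.
Qed.

Fact quot_mulA : associative mul.
Proof.
move=> x y z; elim/quot_pi_ind: x => x; elim/quot_pi_ind: y => y.
elim/quot_pi_ind: z => z; by rewrite !mulE mulrA.
Qed.
Fact quot_mul1l : left_id one mul.
Proof. by move=> x; elim/quot_pi_ind: x => x; rewrite mulE mul1r. Qed.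
Fact quot_mul1r : right_id one mul.
Proof. by move=> x; elim/quot_pi_ind: x => x; rewrite mulE mulr1. Qed.
Fact quot_mulDl : left_distributive mul +%R.
Proof.
move=> x y z; elim/quot_pi_ind: x => x; elim/quot_pi_ind: y => y.
elim/quot_pi_ind: z => z; by rewrite -raddfD !mulE mulrDl raddfD.
Qed.
Fact quot_mulDr : right_distributive mul +%R.
Proof.
move=> x y z; elim/quot_pi_ind: x => x; elim/quot_pi_ind: y => y.
elim/quot_pi_ind: z => z; by rewrite -raddfD !mulE mulrDr raddfD.
Qed.
HB.instance Definition _ := GRing.Zmodule_isPzRing.Build quot_alg
  quot_mulA quot_mul1l quot_mul1r quot_mulDl quot_mulDr.

Fact quot_scaleA a b x : scale a (scale b x) = scale (a * b) x.
Proof. by elim/quot_pi_ind: x => x; rewrite !scaleE scalerA. Qed.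
Fact quot_scale1 : left_id 1 scale.
Proof. by move=> x; elim/quot_pi_ind: x => x; rewrite scaleE scale1r. Qed.
Fact quot_scaleDr : right_distributive scale +%R.
Proof.
move=> a x y; elim/quot_pi_ind: x => x; elim/quot_pi_ind: y => y.
by rewrite -raddfD !scaleE scalerDr raddfD.
Qed.
Fact quot_scaleDl x : {morph scale^~ x : a b / a + b}.
Proof. by elim/quot_pi_ind: x => x a b; rewrite !scaleE scalerDl raddfD. Qed.
Fact quot_scaleAl a (x y : quot_alg) : scale a (x * y) = scale a x * y.
Proof.
elim/quot_pi_ind: x => x; elim/quot_pi_ind: y => y.
by rewrite scaleE [LHS](congr1 (scale a) (mulE x y)) scaleE
  [RHS]mulE pz_scalerAl.
Qed.
Fact quot_scaleAr a (x y : quot_alg) : scale a (x * y) = x * scale a y.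
Proof.
elim/quot_pi_ind: x => x; elim/quot_pi_ind: y => y.
by rewrite scaleE [LHS](congr1 (scale a) (mulE x y)) scaleE
  [RHS]mulE pz_scalerAr.
Qed.
HB.instance Definition _ := PzRing_isPzAlgebra.Build K quot_alg quot_scaleA
  quot_scale1 quot_scaleDr quot_scaleDl quot_scaleAl quot_scaleAr.
HB.instance Definition _ :=
  GRing.Lmodule.copy quot_alg (@PzAlgebra.sort K quot_alg).

Fact quot_pi_linear : linear quot_pi.
Proof. by move=> a x y; rewrite raddfD; congr (_ + _); exact/esym/scaleE. Qed.
Fact quot_pi_monoid : monoid_morphism quot_pi.
Proof. by split=> // x y; exact/esym/mulE. Qed.
HB.instance Definition _ :=
  GRing.isScalable.Build K A quot_alg *:%R quot_pi (fun a x => esym (scaleE a x)).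
HB.instance Definition _ :=
  GRing.isMonoidMorphism.Build A quot_alg quot_pi quot_pi_monoid.
Definition quot_proj : algHom A quot_alg := AlgHom quot_pi_linear quot_pi_monoid.

End Quotient.
(* The map A / I -> A' / I' induced by f; it is only meaningful when f is     *)
(* additive and maps I into I' (see quot_mapE).                               *)
Definition quot_map (A A' : pzAlgType K) (I : ideal A) (I' : ideal A')
  (f : A -> A') (x : quot_alg I) : quot_alg I' := quot_pi I' (f (repr x)).

Lemma quot_mapE (A A' : pzAlgType K) (I : ideal A) (I' : ideal A')
    (f : A -> A') x :
  zmod_morphism f -> {homo f : y / y \in ideal_pred I >-> y \in ideal_pred I'} ->
  quot_map I' f (quot_pi I x) = quot_pi I' (f x).
Proof. by move=> fB fI; apply/quot_piP; rewrite -fB fI ?repr_quot_pi. Qed.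

Section IdealConstructions.
Variables (A : pzAlgType K).

Definition sum_ideal_pred (I J : ideal A) : {pred A} :=
  fun x => `[< exists y z, [/\ y \in ideal_pred I, z \in ideal_pred J & x = y + z] >].

Fact sum_ideal_zmod I J : zmod_closed (sum_ideal_pred I J).
Proof.
split=> [|x x' /asboolP[y [z [Iy Jz ->]]] /asboolP[y' [z' [Iy' Jz' ->]]]].
  by apply/asboolP; exists 0, 0; rewrite !rpred0 addr0.
by apply/asboolP; exists (y - y'), (z - z'); rewrite !rpredB // opprD addrACA.
Qed.
Fact sum_idealMl I J a x : x \in sum_ideal_pred I J -> a * x \in sum_ideal_pred I J.
Proof.
move=> /asboolP[y [z [Iy Jz ->]]]; apply/asboolP; exists (a * y), (a * z).
by rewrite mulrDr; split=> //; apply: idealMl.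
Qed.
Fact sum_idealMr I J a x : x \in sum_ideal_pred I J -> x * a \in sum_ideal_pred I J.
Proof.
move=> /asboolP[y [z [Iy Jz ->]]]; apply/asboolP; exists (y * a), (z * a).
by rewrite mulrDl; split=> //; apply: idealMr.
Qed.
Definition sum_ideal I J : ideal A :=
  Ideal (sum_ideal_zmod I J) (@sum_idealMl I J) (@sum_idealMr I J).

Variables (B : pzAlgType K) (f : algHom A B).

Definition ker_ideal_pred : {pred A} := fun x => f x == 0.

Fact ker_ideal_zmod : zmod_closed ker_ideal_pred.
Proof.
by split=> [|x y /eqP fx /eqP fy]; rewrite unfold_in ?raddf0 // raddfB /= fx fy subrr.
Qed.
Fact ker_idealMl a x : x \in ker_ideal_pred -> a * x \in ker_ideal_pred.
Proof. by move=> /eqP fx; rewrite unfold_in rmorphM /= fx mulr0. Qed.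
Fact ker_idealMr a x : x \in ker_ideal_pred -> x * a \in ker_ideal_pred.
Proof. by move=> /eqP fx; rewrite unfold_in rmorphM /= fx mul0r. Qed.
Definition ker_ideal : ideal A := Ideal ker_ideal_zmod ker_idealMl ker_idealMr.

End IdealConstructions.
End Ideals.

Arguments ideal_pred : simpl never.
Arguments sum_ideal : simpl never.
Arguments ker_ideal : simpl never.

Section Coverings.
Variables (K : pzRingType) (A : pzAlgType K) (X : finType) (J : X -> ideal A).

Definition covering : Prop := forall x, (forall i, x \in ideal_pred (J i)) -> x = 0.

Definition nontrivial_covering : Prop :=
  covering /\ forall i, exists2 x, x \in ideal_pred (J i) & x != 0.

(* The canonical maps pi^i_j : A / J i -> A / (J i + J j) and pi^j_i; the      *)
(* latter is given the target A / (J i + J j) rather than A / (J j + J i), so  *)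
(* that their values can be compared.                                          *)
Definition to_suml i j : quot_alg (J i) -> quot_alg (sum_ideal (J i) (J j)) :=
  quot_map (sum_ideal (J i) (J j)) id.
Definition to_sumr i j : quot_alg (J j) -> quot_alg (sum_ideal (J i) (J j)) :=
  quot_map (sum_ideal (J i) (J j)) id.

Lemma to_sumlE i j x : to_suml j (quot_pi (J i) x) = quot_pi _ x.
Proof.
apply: quot_mapE => // y Jy; apply/asboolP; exists y, 0.
by rewrite rpred0 addr0.
Qed.
Lemma to_sumrE i j x : to_sumr i (quot_pi (J j) x) = quot_pi _ x.
Proof.
apply: quot_mapE => // y Jy; apply/asboolP; exists 0, y.
by rewrite rpred0 add0r.
Qed.

Definition compatible (a : {dffun forall i, quot_alg (J i)}) : bool :=
  [forall i, forall j, to_suml j (a i) == to_sumr i (a j)].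

Record completion := Completion {
  completion_val :> {dffun forall i, quot_alg (J i)};
  completion_compatible : compatible completion_val
}.
HB.instance Definition _ := [isSub for completion_val].
HB.instance Definition _ := [Choice of completion by <:].

Implicit Types a b c : completion.

Lemma completionP a b : (forall i, a i = b i) -> a = b.
Proof. by move=> ab; apply/val_inj/ffunP. Qed.

Lemma compatibleP (f : forall i, quot_alg (J i)) :
  (forall i j, exists x y, [/\ f i = quot_pi _ x, f j = quot_pi _ y &
     x - y \in ideal_pred (sum_ideal (J i) (J j))]) ->
  compatible [ffun i => f i].
Proof.
move=> h; apply/forallP=> i; apply/forallP=> j; apply/eqP; rewrite !ffunE.
by have [x [y [-> -> xy]]] := h i j; rewrite to_sumlE to_sumrE; apply/quot_piP.
Qed.

Lemma completion_repr a i j :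
  repr (a i) - repr (a j) \in ideal_pred (sum_ideal (J i) (J j)).
Proof.
apply/quot_piP; rewrite -to_sumlE -to_sumrE !quot_pi_repr; apply/eqP.
by have /forallP/(_ i)/forallP/(_ j) := completion_compatible a.
Qed.

Definition completion_of f h := Completion (@compatibleP f h).

Fact completion_zero_compat i j : exists x y,
  [/\ 0 = quot_pi (J i) x, 0 = quot_pi (J j) y &
      x - y \in ideal_pred (sum_ideal (J i) (J j))].
Proof. by exists 0, 0; rewrite subrr rpred0 !raddf0. Qed.

Fact completion_opp_compat a i j : exists x y,
  [/\ - a i = quot_pi (J i) x, - a j = quot_pi (J j) y &
      x - y \in ideal_pred (sum_ideal (J i) (J j))].
Proof.
exists (- repr (a i)), (- repr (a j)); rewrite !raddfN /= !quot_pi_repr.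
by split=> //; rewrite -opprD rpredN completion_repr.
Qed.

Fact completion_add_compat a b i j : exists x y,
  [/\ a i + b i = quot_pi (J i) x, a j + b j = quot_pi (J j) y &
      x - y \in ideal_pred (sum_ideal (J i) (J j))].
Proof.
exists (repr (a i) + repr (b i)), (repr (a j) + repr (b j)).
rewrite !raddfD /= !quot_pi_repr; split=> //.
by rewrite addrACA rpredD ?completion_repr.
Qed.

Fact completion_one_compat i j : exists x y,
  [/\ 1 = quot_pi (J i) x, 1 = quot_pi (J j) y &
      x - y \in ideal_pred (sum_ideal (J i) (J j))].
Proof. by exists 1, 1; rewrite subrr rpred0. Qed.

Fact completion_mul_compat a b i j : exists x y,
  [/\ a i * b i = quot_pi (J i) x, a j * b j = quot_pi (J j) y &
      x - y \in ideal_pred (sum_ideal (J i) (J j))].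
Proof.
exists (repr (a i) * repr (b i)), (repr (a j) * repr (b j)).
rewrite !rmorphM /= !quot_pi_repr; split=> //.
set x := repr (a i); set y := repr (b i); set x' := repr (a j).
set y' := repr (b j).
have -> : x * y - x' * y' = x * (y - y') + (x - x') * y'.
  by rewrite mulrBr mulrBl addrA subrK.
by apply: rpredD; [apply: idealMl | apply: idealMr]; exact: completion_repr.
Qed.

Fact completion_scale_compat (k : K) a i j : exists x y,
  [/\ k *: a i = quot_pi (J i) x, k *: a j = quot_pi (J j) y &
      x - y \in ideal_pred (sum_ideal (J i) (J j))].
Proof.
exists (k *: repr (a i)), (k *: repr (a j)).
rewrite !linearZ /= !quot_pi_repr; split=> //.
rewrite -scalerDr -[_ - _]mul1r pz_scalerAl.
by apply: idealMl; exact: completion_repr.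
Qed.

Let zero := completion_of completion_zero_compat.
Let opp a := completion_of (completion_opp_compat a).
Let add a b := completion_of (completion_add_compat a b).
Let one := completion_of completion_one_compat.
Let mul a b := completion_of (completion_mul_compat a b).
Let scale k a := completion_of (completion_scale_compat k a).

Fact completion_addA : associative add.
Proof. by move=> a b c; apply/completionP=> i; rewrite !ffunE addrA. Qed.
Fact completion_addC : commutative add.
Proof. by move=> a b; apply/completionP=> i; rewrite !ffunE addrC. Qed.
Fact completion_add0 : left_id zero add.
Proof. by move=> a; apply/completionP=> i; rewrite !ffunE add0r. Qed.
Fact completion_addN : left_inverse zero opp add.
Proof. by move=> a; apply/completionP=> i; rewrite !ffunE addNr. Qed.
HB.instance Definition _ := GRing.isZmodule.Build completion
  completion_addA completion_addC completion_add0 completion_addN.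

Fact completion_mulA : associative mul.
Proof. by move=> a b c; apply/completionP=> i; rewrite !ffunE mulrA. Qed.
Fact completion_mul1l : left_id one mul.
Proof. by move=> a; apply/completionP=> i; rewrite !ffunE mul1r. Qed.
Fact completion_mul1r : right_id one mul.
Proof. by move=> a; apply/completionP=> i; rewrite !ffunE mulr1. Qed.
Fact completion_mulDl : left_distributive mul add.
Proof. by move=> a b c; apply/completionP=> i; rewrite !ffunE mulrDl. Qed.
Fact completion_mulDr : right_distributive mul add.
Proof. by move=> a b c; apply/completionP=> i; rewrite !ffunE mulrDr. Qed.
HB.instance Definition _ := GRing.Zmodule_isPzRing.Build completion
  completion_mulA completion_mul1l completion_mul1r completion_mulDl
  completion_mulDr.

Fact completion_scaleA k l a : scale k (scale l a) = scale (k * l) a.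
Proof. by apply/completionP=> i; rewrite !ffunE scalerA. Qed.
Fact completion_scale1 : left_id 1 scale.
Proof. by move=> a; apply/completionP=> i; rewrite !ffunE scale1r. Qed.
Fact completion_scaleDr : right_distributive scale +%R.
Proof. by move=> k a b; apply/completionP=> i; rewrite !ffunE scalerDr. Qed.
Fact completion_scaleDl a : {morph scale^~ a : k l / k + l}.
Proof. by move=> k l; apply/completionP=> i; rewrite !ffunE scalerDl. Qed.
Fact completion_scaleAl (k : K) a b : scale k (a * b) = scale k a * b.
Proof. by apply/completionP=> i; rewrite !ffunE pz_scalerAl. Qed.
Fact completion_scaleAr (k : K) a b : scale k (a * b) = a * scale k b.
Proof. by apply/completionP=> i; rewrite !ffunE pz_scalerAr. Qed.
HB.instance Definition _ := PzRing_isPzAlgebra.Build K completion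
  completion_scaleA completion_scale1 completion_scaleDr completion_scaleDl
  completion_scaleAl completion_scaleAr.
HB.instance Definition _ :=
  GRing.Lmodule.copy completion (@PzAlgebra.sort K completion).

Section Projection.
Variable i : X.
Let proj (a : completion) : quot_alg (J i) := a i.
Fact completion_proj_linear : linear proj.
Proof. by move=> k a b; rewrite /proj !ffunE. Qed.
Fact completion_proj_monoid : monoid_morphism proj.
Proof. by split=> [|a b]; rewrite /proj ffunE. Qed.
Definition completion_proj : algHom completion (quot_alg (J i)) :=
  AlgHom completion_proj_linear completion_proj_monoid.
End Projection.

Fact canonical_compat (z : A) i j : exists x y,
  [/\ quot_pi (J i) z = quot_pi (J i) x, quot_pi (J j) z = quot_pi (J j) y &
      x - y \in ideal_pred (sum_ideal (J i) (J j))].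
Proof. by exists z, z; rewrite subrr rpred0. Qed.

Definition to_completion (z : A) : completion := completion_of (canonical_compat z).

Definition complete : Prop := forall a, exists z, to_completion z = a.

End Coverings.

Section DifferentialAlgebras.
Variable K : pzRingType.

(* A differential algebra over A with underlying algebra G.  The direct sum    *)
(* decomposition of G is given by the projections da_pr n onto the homogeneous *)
(* components G^n = {x | da_pr n x = x}; by da_pr_pr and da_pr_sum every x is  *)
(* the finite sum of its components.  The algebra A is identified with G^0 by  *)
(* the injective homomorphism da_incl, so that in particular 1 lies in G^0.    *)
Record diff_algebra (A G : pzAlgType K) := DiffAlgebra {
  da_pr : nat -> {linear G -> G};
  da_d : {linear G -> G};
  da_incl : algHom A G;
  da_pr_pr : forall m n x,
    da_pr m (da_pr n x) = if m == n then da_pr n x else 0;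
  da_pr_sum : forall x, exists N, x = \sum_(n < N) da_pr n x;
  da_pr_mul : forall m n x y, da_pr m x = x -> da_pr n y = y ->
    da_pr (m + n) (x * y) = x * y;
  da_incl_inj : injective da_incl;
  da_incl_range : forall x, da_pr 0 x = x <-> exists a, da_incl a = x;
  da_d_deg : forall n x, da_pr n x = x -> da_pr n.+1 (da_d x) = da_d x;
  da_leibniz : forall n x y, da_pr n x = x ->
    da_d (x * y) = da_d x * y + (-1) ^+ n * x * da_d y;
  da_dd : forall x, da_d (da_d x) = 0
}.

Section Basics.
Variables (A G : pzAlgType K) (D : diff_algebra A G).

Definition homogeneous n (x : G) : Prop := da_pr D n x = x.

Definition diff_calculus : Prop := forall n x, homogeneous n x ->
  exists s : seq (A * n.-tuple A),
    x = \sum_(t <- s) da_incl D t.1 * \prod_(a <- t.2) da_d D (da_incl D a).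

Definition diff_ideal (I : ideal G) : Prop :=
  (forall x, x \in ideal_pred I -> da_d D x \in ideal_pred I) /\
  (forall n x, x \in ideal_pred I -> da_pr D n x \in ideal_pred I).

Definition deg0_pred (I : ideal G) : {pred A} :=
  fun a => `[< exists2 x, x \in ideal_pred I & da_incl D a = da_pr D 0 x >].

Variables (I : ideal G) (hI : diff_ideal I).

Lemma homogeneous_incl a : homogeneous 0 (da_incl D a).
Proof. by apply/da_incl_range; exists a. Qed.

Lemma deg0_predE a : (a \in deg0_pred I) = (da_incl D a \in ideal_pred I).
Proof.
apply/asboolP/idP => [[x Ix ->]|Ia]; first exact: hI.2.
by exists (da_incl D a); rewrite ?homogeneous_incl.
Qed.

Fact deg0_zmod : zmod_closed (deg0_pred I).
Proof.
by split=> [|a b]; rewrite !deg0_predE ?raddf0 ?rpred0 // raddfB; apply: rpredB.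
Qed.
Fact deg0_Ml a b : b \in deg0_pred I -> a * b \in deg0_pred I.
Proof. by rewrite !deg0_predE rmorphM; apply: idealMl. Qed.
Fact deg0_Mr a b : b \in deg0_pred I -> b * a \in deg0_pred I.
Proof. by rewrite !deg0_predE rmorphM; apply: idealMr. Qed.
(* pr_0(I), as an ideal of A. *)
Definition deg0_ideal : ideal A := Ideal deg0_zmod deg0_Ml deg0_Mr.

End Basics.

Section QuotientDifferentialAlgebra.
Variables (A G : pzAlgType K) (D : diff_algebra A G).
Variables (I : ideal G) (hI : diff_ideal D I).

Let qpr n : quot_alg I -> quot_alg I := quot_map I (da_pr D n).
Let qd : quot_alg I -> quot_alg I := quot_map I (da_d D).
Let qincl : quot_alg (deg0_ideal hI) -> quot_alg I := quot_map I (da_incl D).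

Let qprE n x : qpr n (quot_pi I x) = quot_pi I (da_pr D n x).
Proof. by apply: quot_mapE => [y z|y]; [rewrite raddfB | apply: hI.2]. Qed.
Let qdE x : qd (quot_pi I x) = quot_pi I (da_d D x).
Proof. by apply: quot_mapE => [y z|y]; [rewrite raddfB | apply: hI.1]. Qed.
Let qinclE a : qincl (quot_pi _ a) = quot_pi I (da_incl D a).
Proof.
apply: quot_mapE => [y z|y]; first by rewrite raddfB.
by rewrite -(deg0_predE hI).
Qed.

Fact quot_pr_linear n : linear (qpr n).
Proof.
move=> a x y; elim/quot_pi_ind: x => x; elim/quot_pi_ind: y => y.
by rewrite -linearP !qprE !linearP.
Qed.
Fact quot_d_linear : linear qd.
Proof.
move=> a x y; elim/quot_pi_ind: x => x; elim/quot_pi_ind: y => y.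
by rewrite -linearP !qdE !linearP.
Qed.
Fact quot_incl_linear : linear qincl.
Proof.
move=> a x y; elim/quot_pi_ind: x => x; elim/quot_pi_ind: y => y.
by rewrite -linearP !qinclE !linearP.
Qed.
Fact quot_incl_monoid : monoid_morphism qincl.
Proof.
split=> [|x y]; first by rewrite -[1](rmorph1 (quot_pi _)) qinclE !rmorph1.
elim/quot_pi_ind: x => x; elim/quot_pi_ind: y => y.
by rewrite -rmorphM !qinclE !rmorphM.
Qed.

Let qpr_lin n : {linear quot_alg I -> quot_alg I} :=
  HB.pack_for {linear quot_alg I -> quot_alg I} (qpr n)
    (GRing.isLinear.Build K (quot_alg I) (quot_alg I) *:%R (qpr n) (quot_pr_linear n)).
Let qd_lin : {linear quot_alg I -> quot_alg I} :=
  HB.pack_for {linear quot_alg I -> quot_alg I} qd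
    (GRing.isLinear.Build K (quot_alg I) (quot_alg I) *:%R qd quot_d_linear).

Fact quot_pr_pr m n x : qpr m (qpr n x) = if m == n then qpr n x else 0.
Proof.
elim/quot_pi_ind: x => x; rewrite !qprE da_pr_pr.
by case: eqP => // _; rewrite raddf0.
Qed.
Fact quot_pr_sum x : exists N, x = \sum_(n < N) qpr n x.
Proof.
elim/quot_pi_ind: x => x; have [N {1}->] := da_pr_sum D x; exists N.
by rewrite raddf_sum; apply: eq_bigr => n _; rewrite qprE.
Qed.
Lemma quot_homogeneous n x : qpr n x = x ->
  exists2 y, homogeneous D n y & x = quot_pi I y.
Proof.
elim/quot_pi_ind: x => x; rewrite qprE => <-; exists (da_pr D n x) => //.
by rewrite /homogeneous da_pr_pr eqxx.
Qed.
Fact quot_pr_mul m n x y :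
  qpr m x = x -> qpr n y = y -> qpr (m + n) (x * y) = x * y.
Proof.
move=> /quot_homogeneous[u um ->] /quot_homogeneous[v vn ->].
by rewrite -rmorphM qprE da_pr_mul.
Qed.
Fact quot_incl_inj : injective qincl.
Proof.
move=> x y; elim/quot_pi_ind: x => x; elim/quot_pi_ind: y => y.
rewrite !qinclE => /quot_piP xy; apply/quot_piP.
by rewrite [_ \in _](deg0_predE hI) raddfB.
Qed.
Fact quot_incl_range x : qpr 0 x = x <-> exists a, qincl a = x.
Proof.
split=> [/quot_homogeneous[y /da_incl_range[a <-] ->]|[a <-]].
  by exists (quot_pi _ a); rewrite qinclE.
elim/quot_pi_ind: a => a; rewrite qinclE qprE.
by rewrite (homogeneous_incl D a).
Qed.
Fact quot_d_deg n x : qpr n x = x -> qpr n.+1 (qd x) = qd x.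
Proof. by move=> /quot_homogeneous[y yn ->]; rewrite qdE qprE da_d_deg. Qed.
Fact quot_leibniz n x y : qpr n x = x ->
  qd (x * y) = qd x * y + (-1) ^+ n * x * qd y.
Proof.
move=> /quot_homogeneous[u un ->]; elim/quot_pi_ind: y => y.
rewrite -rmorphM !qdE (da_leibniz _ un) rmorphD !rmorphM /=.
by rewrite rmorphXn rmorphN1.
Qed.
Fact quot_dd x : qd (qd x) = 0.
Proof. by elim/quot_pi_ind: x => x; rewrite !qdE da_dd raddf0. Qed.

Definition quot_diff_algebra : diff_algebra (quot_alg (deg0_ideal hI)) (quot_alg I) :=
  @DiffAlgebra _ _ qpr_lin qd_lin (AlgHom quot_incl_linear quot_incl_monoid)
    quot_pr_pr quot_pr_sum quot_pr_mul quot_incl_inj quot_incl_range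
    quot_d_deg quot_leibniz quot_dd.

End QuotientDifferentialAlgebra.

Section Adapted.
Variables (A G : pzAlgType K) (D : diff_algebra A G).

Definition diff_extension (A' G' : pzAlgType K) (D' : diff_algebra A' G')
    (f : algHom A A') (F : algHom G G') : Prop :=
  [/\ forall a, F (da_incl D a) = da_incl D' (f a),
      forall n x, homogeneous D n x -> homogeneous D' n (F x) &
      forall x, F (da_d D x) = da_d D' (F x)].

(* For differential calculi an extension F of f is unique when it exists, so   *)
(* the extensions pi_Gamma of the quotient maps are passed as parameters.      *)
Definition adapted (X : finType) (J : X -> ideal A) (G' : X -> pzAlgType K)
    (D' : forall i, diff_algebra (quot_alg (J i)) (G' i))
    (F : forall i, algHom G (G' i)) : Prop :=
  (forall i, diff_extension (D' i) (quot_proj (J i)) (F i)) /\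
  (forall x, (forall i, x \in ideal_pred (ker_ideal (F i))) -> x = 0).

Lemma diff_extension_pr (A' G' : pzAlgType K) (D' : diff_algebra A' G') f F n x :
  @diff_extension A' G' D' f F -> F (da_pr D n x) = da_pr D' n (F x).
Proof.
case=> _ Fh _; have [N ->] := da_pr_sum D x.
rewrite !raddf_sum /=; apply: eq_bigr => m _.
have Fm : da_pr D' m (F (da_pr D m x)) = F (da_pr D m x).
  by apply: Fh; rewrite /homogeneous da_pr_pr eqxx.
by rewrite -Fm !da_pr_pr Fm; case: eqP => // _; rewrite raddf0.
Qed.

Lemma diff_extension_ker (A' G' : pzAlgType K) (D' : diff_algebra A' G') f F :
  @diff_extension A' G' D' f F -> diff_ideal D (ker_ideal F).
Proof.
move=> hF; split=> [x|n x] /eqP Fx; apply/eqP.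
  by case: hF => _ _ ->; rewrite Fx raddf0.
by rewrite (diff_extension_pr _ _ hF) Fx raddf0.
Qed.

End Adapted.

Lemma adapted_ker (A G : pzAlgType K) (D : diff_algebra A G) (X : finType)
    (J : X -> ideal A) (G' : X -> pzAlgType K)
    (D' : forall i, diff_algebra (quot_alg (J i)) (G' i))
    (F : forall i, algHom G (G' i)) :
  adapted D D' F -> forall i, diff_ideal D (ker_ideal (F i)).
Proof. by move=> [hF _] i; apply: diff_extension_ker (hF i). Qed.

(* D' carries the componentwise grading and differential, and the canonical    *)
(* identification of the completion of A with the degree-zero component.       *)
Definition componentwise (A G : pzAlgType K) (D : diff_algebra A G) (X : finType)
    (J : X -> ideal A) (I : X -> ideal G) (hI : forall i, diff_ideal D (I i))
    (D' : diff_algebra (completion J) (completion I)) : Prop :=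
  [/\ forall n (c : completion I) i,
        da_pr D' n c i = da_pr (quot_diff_algebra (hI i)) n (c i),
      forall (c : completion I) i,
        da_d D' c i = da_d (quot_diff_algebra (hI i)) (c i) &
      forall (a : completion J) i z, a i = quot_pi (J i) z ->
        da_incl D' a i = quot_pi (I i) (da_incl D z)].

Definition LC_diff_algebra (A G : pzAlgType K) (D : diff_algebra A G)
    (X : finType) (I : X -> ideal G) : Prop :=
  exists hI : forall i, diff_ideal D (I i),
  [/\ covering I, complete I,
      nontrivial_covering (fun i => deg0_ideal (hI i)) &
      forall i, diff_calculus (quot_diff_algebra (hI i))].

End DifferentialAlgebras.

(* Main.v *)
(* The projections onto degrees, the differential and the inclusion of degree   *)
(* zero respect the ideals I_i = ker pi_iGamma, so they act componentwise on    *)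
(* compatible families.  Since pi_i is differentiable, the degree-zero part of  *)
(* I_i is J_i; applying pr_0 to incl (b_i - b_j) = y + z with y in I_i and z in *)
(* I_j gives b_i - b_j in J_i + J_j, so the degree-zero part of the completion  *)
(* is exactly B_c.  The component maps are already surjective on Gamma(B),      *)
(* which makes each quotient by a component kernel a differential calculus.     *)
Require Import Defs.
From HB Require Import structures.
From mathcomp Require Import all_boot all_order all_algebra.
From mathcomp Require Import reals complex.

Set Implicit Arguments.
Unset Strict Implicit.
Unset Printing Implicit Defensive.

Import GRing.Theory.
Local Open Scope ring_scope.

(** Each $I_i = \ker\pi_{i_\Gamma}$ is a differential ideal, so $pr_n$, $d$ and the inclusion of
    degree zero act on compatible families through [completion_map], and most axioms hold because
    they hold in every component. The essential point is that degree zero of the completion is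
    exactly $B_c$. By [diff_extension_ker_deg0] the degree-zero part of $I_i$ is $J_i$, and by
    [sum_ideal_deg0] that of $I_i + I_j$ lies in $J_i + J_j$; hence a degree-zero family comes from
    a compatible family over $B$ ([completion_incl_range]). The component kernels form a complete
    covering of any completion ([completion_proj_complete]). As $\Gamma(B)$ already maps onto each
    component, its calculus property passes to the quotients ([componentwise_calculus]). *)

Lemma sum_idealP (K : pzRingType) (A : pzAlgType K) (I J : ideal A) x :
  reflect (exists y z, [/\ y \in ideal_pred I, z \in ideal_pred J & x = y + z])
    (x \in ideal_pred (sum_ideal I J)).
Proof. exact: boolp.asboolP. Qed.

Lemma ker_idealP (K : pzRingType) (A B : pzAlgType K) (f : algHom A B) x :
  reflect (f x = 0) (x \in ideal_pred (ker_ideal f)).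
Proof. exact: eqP. Qed.

Lemma quot_pi_eq0P (K : pzRingType) (A : pzAlgType K) (I : ideal A) x :
  reflect (quot_pi I x = 0) (x \in ideal_pred I).
Proof.
by have := quot_piP I x 0; rewrite subr0 raddf0.
Qed.

(** * Completions as algebras and the covering by component kernels *)

Section CompletionElements.
Variables (K : pzRingType) (A : pzAlgType K) (X : finType) (J : X -> ideal A).

Lemma completion_compat (c : completion J) i j x y :
  c i = quot_pi _ x -> c j = quot_pi _ y ->
  x - y \in ideal_pred (sum_ideal (J i) (J j)).
Proof.
move=> cx cy; apply/quot_piP; rewrite -to_sumlE -to_sumrE -cx -cy; apply/eqP.
by have /forallP/(_ i)/forallP/(_ j) := completion_compatible c.
Qed.

Lemma completionDE (a b : completion J) i : (a + b) i = a i + b i.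
Proof. exact: (raddfD (completion_proj J i)). Qed.
Lemma completionME (a b : completion J) i : (a * b) i = a i * b i.
Proof. exact: (rmorphM (completion_proj J i)). Qed.
Lemma completionZE k (a : completion J) i : (k *: a) i = k *: a i.
Proof. exact: (linearZ_LR (completion_proj J i)). Qed.
Lemma completion0E i : (0 : completion J) i = 0.
Proof. exact: (raddf0 (completion_proj J i)). Qed.
Lemma completion1E i : (1 : completion J) i = 1.
Proof. exact: (rmorph1 (completion_proj J i)). Qed.
Lemma completion_sumE N (f : 'I_N -> completion J) i :
  (\sum_(n < N) f n) i = \sum_(n < N) f n i.
Proof. exact: (raddf_sum (completion_proj J i)). Qed.

Lemma completion_ofE f h i : @completion_of K A X J f h i = f i.
Proof. by rewrite ffunE. Qed.

Lemma to_completionE z i : to_completion J z i = quot_pi (J i) z.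
Proof. exact: completion_ofE. Qed.

Fact to_completion_linear : linear (to_completion J).
Proof.
move=> k x y; apply/completionP=> i.
by rewrite completionDE completionZE !to_completionE linearP.
Qed.

Fact to_completion_monoid : monoid_morphism (to_completion J).
Proof.
split=> [|x y]; apply/completionP=> i; rewrite to_completionE //.
by rewrite completionME !to_completionE rmorphM.
Qed.

Definition to_completion_hom : algHom A (completion J) :=
  AlgHom to_completion_linear to_completion_monoid.

Lemma to_completion_inj : covering J -> injective (to_completion J).
Proof.
move=> hJ x y xy; apply/eqP; rewrite -subr_eq0; apply/eqP/hJ => i.
by apply/quot_piP; rewrite -!to_completionE xy.
Qed.

Lemma completion_proj_covering :
  covering (fun i => ker_ideal (completion_proj J i)).
Proof.
move=> c hc; apply/completionP=> i.
by rewrite completion0E; have /ker_idealP := hc i.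
Qed.

End CompletionElements.

(* A family (a_i) in the completion with a_i = a_j modulo the sum of the i-th  *)
(* and j-th kernels is glued along the diagonal, z_i = (a_i)_i.                *)
Lemma completion_proj_complete (K : pzRingType) (A : pzAlgType K) (X : finType)
    (J : X -> ideal A) :
  complete (fun i => ker_ideal (completion_proj J i)).
Proof.
move=> a; pose f i : quot_alg (J i) := (repr (a i) : completion J) i.
have fP i j : exists x y, [/\ f i = quot_pi _ x, f j = quot_pi _ y &
     x - y \in ideal_pred (sum_ideal (J i) (J j))].
  exists (repr (f i)), (repr (f j)); rewrite !quot_pi_repr; split=> //.
  have /sum_idealP[u [v [/ker_idealP /= ui /ker_idealP /= vj uv]]] :=
    completion_repr a i j.
  (* Since $a_i - a_j = u + v$ with $v_j = 0$, the class of [repr (f j) + repr (u j)] is the j-th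
     component of $a_i$, so the first bracket is settled by compatibility of $a_i$. The rest,
     [repr (u j)], is settled by compatibility of $u$, as $u_i = 0$. *)
  have ->: repr (f i) - repr (f j) = (repr (f i) - repr (f j) - repr (u j)) +
      repr (u j) by rewrite subrK.
  apply: rpredD.
    rewrite -addrA -opprD; apply: (@completion_compat _ _ _ _ (repr (a i))).
      by rewrite quot_pi_repr.
    rewrite raddfD /= !quot_pi_repr /f.
    rewrite -{1}[repr (a i)](subrK (repr (a j))) uv !completionDE.
    by rewrite vj addr0 addrC.
  rewrite -[repr _]subr0 -rpredN opprB; apply: (@completion_compat _ _ _ _ u).
    by rewrite raddf0.
  by rewrite quot_pi_repr.
exists (completion_of fP); apply/completionP=> i.
rewrite to_completionE -[RHS]quot_pi_repr; apply/quot_piP/ker_idealP.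
rewrite raddfB; apply/eqP; rewrite subr_eq0; apply/eqP; exact: completion_ofE.
Qed.

(** * Componentwise maps between completions *)

Section CompletionMap.
Variables (K : pzRingType) (A A' : pzAlgType K) (X : finType).
Variables (J : X -> ideal A) (J' : X -> ideal A') (f : A -> A').
Hypothesis fB : zmod_morphism f.
Hypothesis fJ : forall i,
  {homo f : y / y \in ideal_pred (J i) >-> y \in ideal_pred (J' i)}.

Fact completion_map_compat (c : completion J) i j : exists x y,
  [/\ quot_map (J' i) f (c i) = quot_pi _ x,
      quot_map (J' j) f (c j) = quot_pi _ y &
      x - y \in ideal_pred (sum_ideal (J' i) (J' j))].
Proof.
exists (f (repr (c i))), (f (repr (c j))); split=> //.
have f0 : f 0 = 0 by rewrite -(subrr 0) fB subrr.
have fD y z : f (y + z) = f y + f z.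
  by rewrite -{1}[z]opprK -(sub0r z) !fB f0 sub0r opprK.
have /sum_idealP[y [z [yJ zJ yz]]] := completion_repr c i j.
by apply/sum_idealP; exists (f y), (f z); rewrite -fB yz fD !fJ.
Qed.

Definition completion_map (c : completion J) : completion J' :=
  completion_of (completion_map_compat c).

Lemma completion_mapE c i : completion_map c i = quot_map (J' i) f (c i).
Proof. exact: completion_ofE. Qed.

End CompletionMap.

(** Components of index at least $N$ vanish by orthogonality of the projections, so the bound may be
    enlarged. This allows one common bound, a maximum over the finite index set, for all components
    of a family. *)
Lemma da_pr_sum_le (K : pzRingType) (A G : pzAlgType K) (D : diff_algebra A G)
    x : exists N, forall M, (N <= M)%N -> x = \sum_(n < M) da_pr D n x.
Proof.
have [N xN] := da_pr_sum D x; exists N => M NM.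
rewrite (big_ord_widen M (fun n => da_pr D n x)) // in xN.
rewrite {1}xN big_mkcond; apply: eq_bigr => n _; case: ifP => // /negbT nN.
rewrite [in RHS]xN raddf_sum big1 // => m mN /=; rewrite da_pr_pr.
by case: eqP => // nm; rewrite nm mN in nN.
Qed.

Section QuotientValues.
Variables (K : pzRingType) (A G : pzAlgType K) (D : diff_algebra A G).
Variables (I : ideal G) (hI : diff_ideal D I).

Lemma quot_diff_algebra_dE x :
  da_d (quot_diff_algebra hI) (quot_pi I x) = quot_pi I (da_d D x).
Proof. by apply: quot_mapE; [apply: raddfB | apply: hI.1]. Qed.

Lemma quot_diff_algebra_inclE a :
  da_incl (quot_diff_algebra hI) (quot_pi _ a) = quot_pi I (da_incl D a).
Proof.
by apply: quot_mapE => [|b]; [apply: raddfB | rewrite -(deg0_predE hI)].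
Qed.

End QuotientValues.

(** * The differential algebra structure on the completion *)

Section CompletionDiffAlgebra.
Variables (K : pzRingType) (A G : pzAlgType K) (D : diff_algebra A G).
Variables (X : finType) (J : X -> ideal A) (I : X -> ideal G).
Implicit Types c : completion I.
Hypothesis hI : forall i, diff_ideal D (I i).
(** From right to left this makes the inclusion of $B_c$ well defined; from left to right it gives
    its injectivity and its range. *)
Hypothesis deg0I : forall i a,
  (da_incl D a \in ideal_pred (I i)) = (a \in ideal_pred (J i)).

Let Q i := quot_diff_algebra (hI i).

Let cpr n : completion I -> completion I :=
  completion_map (raddfB (da_pr D n)) (fun i => (hI i).2 n).
Let cd : completion I -> completion I :=
  completion_map (raddfB (da_d D)) (fun i => (hI i).1).

Fact deg0_homo i :
  {homo da_incl D : a / a \in ideal_pred (J i) >-> a \in ideal_pred (I i)}.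
Proof. by move=> a; rewrite deg0I. Qed.

Let cincl : completion J -> completion I :=
  completion_map (raddfB (da_incl D)) deg0_homo.

Let cprE n c i : cpr n c i = da_pr (Q i) n (c i).
Proof. exact: completion_mapE. Qed.
Let cdE c i : cd c i = da_d (Q i) (c i).
Proof. exact: completion_mapE. Qed.
Let cinclE (a : completion J) i z :
  a i = quot_pi (J i) z -> cincl a i = quot_pi (I i) (da_incl D z).
Proof.
move=> az; rewrite completion_mapE az quot_mapE //; first exact: raddfB.
exact: deg0_homo.
Qed.

Fact completion_pr_linear n : linear (cpr n).
Proof.
move=> k c c'; apply/completionP=> i.
by rewrite completionDE completionZE !cprE completionDE completionZE linearP.
Qed.
Fact completion_d_linear : linear cd.
Proof.
move=> k c c'; apply/completionP=> i.
by rewrite completionDE completionZE !cdE completionDE completionZE linearP.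
Qed.
Fact completion_incl_linear : linear cincl.
Proof.
move=> k a b; apply/completionP=> i.
have az (a' : completion J) : a' i = quot_pi (J i) (repr (a' i)).
  by rewrite quot_pi_repr.
rewrite completionDE completionZE (cinclE (az a)) (cinclE (az b)).
rewrite (@cinclE _ i (k *: repr (a i) + repr (b i))) ?linearP //.
by rewrite completionDE completionZE /= -!az.
Qed.
Fact completion_incl_monoid : monoid_morphism cincl.
Proof.
split=> [|a b]; apply/completionP=> i.
  rewrite completion1E (@cinclE _ i 1) ?rmorph1 //.
  exact: (rmorph1 (completion_proj J i)).
have az (a' : completion J) : a' i = quot_pi (J i) (repr (a' i)).
  by rewrite quot_pi_repr.
rewrite completionME (cinclE (az a)) (cinclE (az b)).
rewrite (@cinclE _ i (repr (a i) * repr (b i))) ?rmorphM //.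
by rewrite completionME /= -!az.
Qed.

Let cpr_lin n : {linear completion I -> completion I} :=
  HB.pack_for {linear completion I -> completion I} (cpr n)
    (GRing.isLinear.Build K (completion I) (completion I) *:%R (cpr n)
      (completion_pr_linear n)).
Let cd_lin : {linear completion I -> completion I} :=
  HB.pack_for {linear completion I -> completion I} cd
    (GRing.isLinear.Build K (completion I) (completion I) *:%R cd
      completion_d_linear).

Fact completion_pr_pr m n c :
  cpr m (cpr n c) = if m == n then cpr n c else 0.
Proof.
apply/completionP=> i; rewrite !cprE da_pr_pr.
by case: eqP; rewrite ?cprE ?completion0E.
Qed.
Fact completion_pr_sum c : exists N, c = \sum_(n < N) cpr n c.
Proof.
have [N NP] := boolp.choice (fun i => da_pr_sum_le (Q i) (c i)).
exists (\max_i N i)%N; apply/completionP=> i; rewrite completion_sumE.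
rewrite [LHS](NP i _ (leq_bigmax i)).
by apply: eq_bigr => n _; rewrite cprE.
Qed.
Let chom n c i : cpr n c = c -> da_pr (Q i) n (c i) = c i.
Proof. by move=> cn; rewrite -[in RHS]cn cprE. Qed.
Fact completion_pr_mul m n c c' :
  cpr m c = c -> cpr n c' = c' -> cpr (m + n) (c * c') = c * c'.
Proof.
move=> cm cn; apply/completionP=> i; rewrite cprE completionME.
by rewrite da_pr_mul //; apply: chom.
Qed.
Fact completion_incl_inj : injective cincl.
Proof.
move=> a b ab; apply/completionP=> i.
have az (a' : completion J) : a' i = quot_pi (J i) (repr (a' i)).
  by rewrite quot_pi_repr.
rewrite (az a) (az b); apply/quot_piP; rewrite -deg0I raddfB; apply/quot_piP.
by rewrite -(cinclE (az a)) -(cinclE (az b)) ab.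
Qed.

(** Both ideals are stable under $pr_0$, so the two summands may be replaced by their degree-zero
    components. *)
Lemma sum_ideal_deg0 i j a :
  da_incl D a \in ideal_pred (sum_ideal (I i) (I j)) ->
  a \in ideal_pred (sum_ideal (J i) (J j)).
Proof.
move=> /sum_idealP[y [z [yI zI ayz]]].
have deg0 x : exists u, da_incl D u = da_pr D 0 x.
  by apply/da_incl_range; rewrite da_pr_pr eqxx.
have [u uy] := deg0 y; have [v vz] := deg0 z.
apply/sum_idealP; exists u, v; split.
- by rewrite -deg0I uy; apply: (hI i).2.
- by rewrite -deg0I vz; apply: (hI j).2.
apply: (@da_incl_inj _ _ _ D).
by rewrite raddfD /= uy vz -raddfD -ayz; apply/esym/homogeneous_incl.
Qed.

Fact completion_incl_range c : cpr 0 c = c <-> exists a, cincl a = c.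
Proof.
split=> [c0|[a <-]]; last first.
  apply/completionP=> i; rewrite cprE.
  apply/da_incl_range; exists (quot_pi _ (repr (a i))).
  by rewrite quot_diff_algebra_inclE; apply/esym/cinclE; rewrite quot_pi_repr.
(* Lift each degree-zero component to $B$; the lifts are compatible modulo $J_i + J_j$ by
   [sum_ideal_deg0]. *)
have /boolp.choice[b bP] i : exists b, c i = quot_pi (I i) (da_incl D b).
  have /(quot_homogeneous (hI i))[y /da_incl_range[b by_] ->] := chom i c0.
  by exists b; rewrite by_.
have bJ i j : exists x y,
    [/\ quot_pi (J i) (b i) = quot_pi _ x, quot_pi (J j) (b j) = quot_pi _ y &
        x - y \in ideal_pred (sum_ideal (J i) (J j))].
  exists (b i), (b j); split=> //; apply: sum_ideal_deg0.
  by rewrite raddfB; apply: (completion_compat (bP i) (bP j)).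
exists (completion_of bJ); apply/completionP=> i; rewrite bP.
by apply: cinclE; rewrite completion_ofE.
Qed.
Fact completion_d_deg n c : cpr n c = c -> cpr n.+1 (cd c) = cd c.
Proof.
move=> cn; apply/completionP=> i; rewrite cprE cdE.
by apply: da_d_deg; apply: chom.
Qed.
Fact completion_leibniz n c c' : cpr n c = c ->
  cd (c * c') = cd c * c' + (-1) ^+ n * c * cd c'.
Proof.
move=> cn; apply/completionP=> i.
rewrite completionDE !completionME !cdE completionME (da_leibniz _ (chom i cn)).
by rewrite -[X in _ = _ + X * _ * _]/(completion_proj I i _) rmorphXn rmorphN1.
Qed.
Fact completion_dd c : cd (cd c) = 0.
Proof. by apply/completionP=> i; rewrite !cdE da_dd completion0E. Qed.

Definition completion_diff_algebra : diff_algebra (completion J) (completion I) :=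
  @DiffAlgebra _ _ _ cpr_lin cd_lin
    (AlgHom completion_incl_linear completion_incl_monoid)
    completion_pr_pr completion_pr_sum completion_pr_mul completion_incl_inj
    completion_incl_range completion_d_deg completion_leibniz completion_dd.

Lemma completion_diff_algebra_componentwise :
  componentwise hI completion_diff_algebra.
Proof. by split; [apply: cprE | apply: cdE | apply: cinclE]. Qed.

(** * The LC property of a componentwise structure *)

Variable Dc : diff_algebra (completion J) (completion I).
Hypothesis Dc_comp : componentwise hI Dc.

Lemma componentwise_ker_diff_ideal i :
  diff_ideal Dc (ker_ideal (completion_proj I i)).
Proof.
have [prE dE _] := Dc_comp.
split=> [c|n c] /ker_idealP /= ci; apply/ker_idealP => /=.
  by rewrite dE ci raddf0.
by rewrite prE ci raddf0.
Qed.

Lemma componentwise_deg0 i (a : completion J) :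
  (a \in ideal_pred (deg0_ideal (componentwise_ker_diff_ideal i))) = (a i == 0).
Proof.
have [_ _ inclE] := Dc_comp.
rewrite [LHS](deg0_predE (componentwise_ker_diff_ideal i)).
rewrite -[LHS]/(da_incl Dc a i == 0).
have [z az] : exists z, a i = quot_pi (J i) z.
  by exists (repr (a i)); rewrite quot_pi_repr.
rewrite (inclE _ _ _ az) az.
by apply/eqP/eqP => /quot_pi_eq0P h; apply/quot_pi_eq0P; move: h; rewrite deg0I.
Qed.

(** A nonzero $x \in J_i$ yields a nonzero element of the i-th ideal by its diagonal image, because
    $B$ embeds in $B_c$. *)
Lemma componentwise_nontrivial : nontrivial_covering J ->
  nontrivial_covering (fun i => deg0_ideal (componentwise_ker_diff_ideal i)).
Proof.
move=> [covJ ntJ]; split=> [a ha|i].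
  apply/completionP=> i; have /eqP -> : a i == 0.
    by rewrite -componentwise_deg0.
  by rewrite completion0E.
have [x Jx x0] := ntJ i; exists (to_completion J x).
  by rewrite componentwise_deg0 to_completionE; apply/eqP/quot_pi_eq0P.
apply: contra_neq x0 => cx0; apply: (to_completion_inj covJ).
by rewrite cx0; apply/esym/(raddf0 (to_completion_hom J)).
Qed.

Lemma to_completion_incl a :
  to_completion I (da_incl D a) = da_incl Dc (to_completion J a).
Proof.
have [_ _ inclE] := Dc_comp; apply/completionP=> i.
by rewrite to_completionE (inclE _ _ a) // to_completionE.
Qed.

Lemma to_completion_d x : to_completion I (da_d D x) = da_d Dc (to_completion I x).
Proof.
have [_ dE _] := Dc_comp; apply/completionP=> i.
by rewrite dE !to_completionE quot_diff_algebra_dE.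
Qed.

Lemma componentwise_calculus i : diff_calculus D ->
  diff_calculus (quot_diff_algebra (componentwise_ker_diff_ideal i)).
Proof.
have [prE _ _] := Dc_comp; set hN := componentwise_ker_diff_ideal i.
set N := ker_ideal _ in hN * => hD n x /(quot_homogeneous hN)[c cn ->].
have /(quot_homogeneous (hI i))[y yn cy] : da_pr (Q i) n (c i) = c i.
  by rewrite -prE cn.
(* [phi] is a homomorphism from $\Gamma(B)$ that respects inclusions ([qi]) and differentials
   ([qd]), so it preserves sums of products $a_0\,da_1\cdots da_n$. *)
pose phi u := quot_pi N (to_completion_hom I u).
have phi0 : phi 0 = 0 by rewrite /phi !raddf0.
have phi1 : phi 1 = 1 by rewrite /phi !rmorph1.
have phiD u v : phi (u + v) = phi u + phi v by rewrite /phi !raddfD.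
have phiM u v : phi (u * v) = phi u * phi v by rewrite /phi !rmorphM.
(* Modulo [N] only the i-th component counts, and [y] is a degree-$n$ lift of it. *)
have -> : quot_pi N c = phi y.
  by apply/quot_piP/ker_idealP; rewrite raddfB /= to_completionE cy subrr.
have [s ->] := hD n y yn.
pose q a : quot_alg (deg0_ideal hN) := quot_pi _ (to_completion J a).
have qi a : da_incl (quot_diff_algebra hN) (q a) = phi (da_incl D a).
  by rewrite quot_diff_algebra_inclE -to_completion_incl.
have qd u : da_d (quot_diff_algebra hN) (phi u) = phi (da_d D u).
  by rewrite quot_diff_algebra_dE -to_completion_d.
exists [seq (q t.1, map_tuple q t.2) | t <- s].
rewrite big_map (big_morph phi phiD phi0).
apply: eq_bigr => t _; rewrite [fst (_, _)]/= [snd (_, _)]/= qi phiM.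
congr (_ * _); rewrite (big_morph phi phiM phi1) big_map.
by apply: eq_bigr => a _; rewrite qi qd.
Qed.

Lemma componentwise_LC : nontrivial_covering J -> diff_calculus D ->
  LC_diff_algebra Dc (fun i => ker_ideal (completion_proj I i)).
Proof.
move=> hJ hD; exists componentwise_ker_diff_ideal; split.
- exact: completion_proj_covering.
- exact: completion_proj_complete.
- exact: componentwise_nontrivial.
- by move=> i; apply: componentwise_calculus.
Qed.

End CompletionDiffAlgebra.

(** * Degree zero of the kernels, and conclusion *)

Lemma diff_extension_ker_deg0 (K : pzRingType) (A G A' G' : pzAlgType K)
    (D : diff_algebra A G) (D' : diff_algebra A' G')
    (f : algHom A A') (F : algHom G G') a :
  diff_extension D D' f F ->
  (da_incl D a \in ideal_pred (ker_ideal F)) = (a \in ideal_pred (ker_ideal f)).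
Proof.
case=> Ff _ _; apply/ker_idealP/ker_idealP; rewrite Ff => h.
  by apply: (@da_incl_inj _ _ _ D'); rewrite h raddf0.
by rewrite h raddf0.
Qed.

Lemma ker_quot_proj (K : pzRingType) (A : pzAlgType K) (I : ideal A) a :
  (a \in ideal_pred (ker_ideal (quot_proj I))) = (a \in ideal_pred I).
Proof. exact/ker_idealP/quot_pi_eq0P. Qed.

Theorem proposition13 (R : realType) (B : pzAlgType R[i])
    (X : finType) (J : X -> ideal B) (hJ : nontrivial_covering J)
    (G : pzAlgType R[i]) (D : diff_algebra B G) (hD : diff_calculus D)
    (G' : X -> pzAlgType R[i])
    (D' : forall i, diff_algebra (quot_alg (J i)) (G' i))
    (hD' : forall i, diff_calculus (D' i))
    (piG : forall i, algHom G (G' i)) (hpi : adapted D D' piG) :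
  let I := fun i => ker_ideal (piG i) in
  exists Dc : diff_algebra (completion J) (completion I),
    componentwise (adapted_ker hpi) Dc /\
    LC_diff_algebra Dc (fun i => ker_ideal (completion_proj I i)).
Proof.
move=> I.
have deg0I i a : (da_incl D a \in ideal_pred (I i)) = (a \in ideal_pred (J i)).
  by rewrite (diff_extension_ker_deg0 _ (hpi.1 i)) ker_quot_proj.
have hcomp := completion_diff_algebra_componentwise (adapted_ker hpi) deg0I.
exists (completion_diff_algebra (adapted_ker hpi) deg0I); split=> //.
exact: componentwise_LC hcomp hJ hD.
Qed.
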